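(* Let $\varphi$ be a quantifier-free conjunction of literals with free variables $\vec v$, and let $v\in\vec v$. Let $G=\langle N,E,L,\mathit{root}\rangle=\mathit{egraph}(\varphi)$, let $n_v$ be the node of $G$ with $L(n_v)=v$, and let $r$ and $\mathit{core}$ be the representative function and core computed by $\mathrm{QEL}(\varphi,\vec v)$. Let $NS=\{n\in\mathit{core}\mid \mathit{class}(n)\cap\mathit{core}\neq\{n\}\}$. If either (1) there exists a ground term $t$ such that $\varphi\models v\approx t$, or (2) $n_v$ is not reachable in $G_r$ from any node of $NS$, then $v$ does not occur in the output formula $\mathrm{QEL}(\varphi,\vec v)$.
   Context: Work in multi-sorted first-order logic whose signature has only function symbols and constants; predicates are $\mathsf{Bool}$-valued functions, and a literal $P(a)$ (resp. $\neg P(a)$) abbreviates $P(a)\approx\top$ (resp. $P(a)\approx\bot$), so $\varphi$ is a conjunction of equalities. Entailment $\models$ is that of the theory of equality with uninterpreted functions. A term is ground if it contains no variables. Egraph: $G=\langle N,E,L,\mathit{root}\rangle$, where $\langle N,E\rangle$ is a finite DAG with ordered successors ($n[i]$ the $i$-th child, $\deg(n)$ out-degree, leaf = out-degree 0; $\mathit{parents}(n)$, $\mathit{children}(n)$ as usual), $L$ labels nodes with function symbols or variables, and $\rho_{\mathit{root}}=\{(n,n')\mid\mathit{root}(n)=\mathit{root}(n')\}$ is an equivalence relation closed under congruence, where $n,n'$ are congruent if $L(n)=L(n')$, $\deg(n)=\deg(n')>0$ and $(n[i],n'[i])\in\rho_{\mathit{root}}$ for all $i$. $\mathit{class}(n)=\rho_{\mathit{root}}(n)$;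 $\mathit{ntt}(n)=L(n)$ if $\deg(n)=0$, else $L(n)(\mathit{ntt}(n[1]),\dots)$; distinct nodes have distinct terms. $\mathit{egraph}(\varphi)$ has one node per subterm of $\varphi$ and $\rho_{\mathit{root}}$ is the congruence closure of the equalities of $\varphi$. For $r:N\to N\cup\{\star\}$, $G_r=\langle N,E_r\rangle$ with $E_r=\{(n,r(c))\mid c\in\mathit{children}(n),\ r(c)\neq\star\}$; reachability in $G_r$ is via a directed path, possibly of length zero. $\mathit{toexpr}(n,r)=L(n)$ if $\deg(n)=0$, else $L(n)(\mathit{toexpr}(r(n[1]),r),\dots,\mathit{toexpr}(r(n[\deg(n)]),r))$. $\mathit{toformula}(r,S)$: for every node $m$ with $r(m)=m$ and every $n\in\mathit{class}(m)\setminus\{m\}$ with $n\notin S$, produce the literal $\mathit{toexpr}(m,r)\approx\mathit{toexpr}(n,r)$; return the conjunction of all produced literals. $\mathrm{QEL}(\varphi,\vec v)$: build $G=\mathit{egraph}(\varphi)$; $r:=\mathit{finddefs}(\vec v)$; $r:=\mathit{refinedefs}(r,\vec v)$; $\mathit{core}:=\mathit{findcore}(r)$; return $\mathit{toformula}(r,N\setminus\mathit{core})$. $\mathit{finddefs}$: set $r(n):=\star$ for all $n$; run $\mathit{process}$ with $\mathit{todo}$ = the set of leaves whose term is ground; then run $\mathit{process}$ with $\mathit{todo}$ = the set of all leaves; return $r$. $\mathit{process}$: while $\mathit{todo}\neq\emptyset$, remove some node $n$ from $\mathit{todo}$; if $r(n)\neq\star$ continue; otherwise set $r(n'):=n$ for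 all $n'\in\mathit{class}(n)$, and for every $n'\in\mathit{class}(n)$ and every $p\in\mathit{parents}(n')$ such that $r(c)\neq\star$ for all $c\in\mathit{children}(p)$, add $p$ to $\mathit{todo}$. $\mathit{refinedefs}(r,\vec v)$: for each node $n$ with $r(n)=n$ and $L(n)\in\vec v$: let $r_0:=n$; for the nodes $n'\in\mathit{class}(n)\setminus\{n\}$ in turn, if $L(n')\notin\vec v$ and reassigning all of $\mathit{class}(n)$ to $n'$ would not create a cycle in $G_r$, set $r_0:=n'$ and stop the search; then set $r(n''):=r_0$ for all $n''\in\mathit{class}(n)$. Return $r$. $\mathit{findcore}(r)$: $\mathit{core}:=\emptyset$; for each $n$ with $r(n)=n$: add $n$ to $\mathit{core}$; for each $n'\in\mathit{class}(n)\setminus\{n\}$: if $L(n')\in\vec v$, skip it; else if some $m\in\mathit{core}$ is congruent with $n'$, skip it; else add $n'$ to $\mathit{core}$. Return $\mathit{core}$. (The orders in which sets are traversed are arbitrary.) *)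

(* Defs.v *)
From HB Require Import structures.
From Stdlib Require List.
From mathcomp Require Import all_boot.

Set Implicit Arguments.
Unset Strict Implicit.
Unset Printing Implicit Defensive.

(* A multi-sorted signature together with the sorted variables.  A constant is
   a symbol with [dom f = [::]].  [top_sym] and [bot_sym] are ordinary constants:
   nothing is assumed about their interpretation (see [entails]). *)
Record signature := Signature {
  sort : eqType;
  sym : eqType;
  var : eqType;
  dom : sym -> seq sort;
  cod : sym -> sort;
  vsort : var -> sort;
  bool_sort : sort;
  top_sym : sym;
  bot_sym : sym;
  dom_top : dom top_sym = [::];
  cod_top : cod top_sym = bool_sort;
  dom_bot : dom bot_sym = [::];
  cod_bot : cod bot_sym = bool_sort
}.

Unset Elimination Schemes.
Inductive term (Sg : signature) : Type :=
| Var (x : var Sg)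
| App (f : sym Sg) (ts : seq (term Sg)).
Set Elimination Schemes.
Arguments Var {Sg} _.
Arguments App {Sg} _ _.

Definition term_ind (Sg : signature) (P : term Sg -> Prop)
    (Pvar : forall x, P (Var x))
    (Papp : forall f ts, foldr (fun t Q => P t /\ Q) True ts -> P (App f ts)) :
    forall t, P t :=
  fix loop t : P t :=
    match t with
    | Var x => Pvar x
    | App f ts =>
        let fix all_loop us : foldr (fun t Q => P t /\ Q) True us :=
          match us with
          | [::] => I
          | u :: us' => conj (loop u) (all_loop us')
          end in
        Papp f ts (all_loop ts)
    end.

Section TermEq.
Context {Sg : signature}.

Fixpoint term_encode (t : term Sg) : GenTree.tree (sym Sg + var Sg)%type :=
  match t with
  | Var x => GenTree.Leaf (inr x)
  | App f ts => GenTree.Node 0 (GenTree.Leaf (inl f) :: map term_encode ts)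
  end.

Fixpoint term_decode (u : GenTree.tree (sym Sg + var Sg)%type)
    : option (term Sg) :=
  match u with
  | GenTree.Leaf (inr x) => Some (Var x)
  | GenTree.Node _ (GenTree.Leaf (inl f) :: us) =>
      Some (App f (pmap term_decode us))
  | _ => None
  end.

Lemma term_encodeK : pcancel term_encode term_decode.
Proof.
elim=> [x|f ts IH] //=; congr (Some (App f _)).
by elim: ts IH => //= t ts IHts [-> /IHts ->].
Qed.

HB.instance Definition _ := Equality.copy (term Sg) (pcan_type term_encodeK).

End TermEq.

Section Syntax.
Context {Sg : signature}.

Fixpoint tsort (t : term Sg) : option (sort Sg) :=
  match t with
  | Var x => Some (vsort x)
  | App f ts =>
      if map tsort ts == map Some (dom f) then Some (cod f) else None
  end.

Fixpoint tvars (t : term Sg) : seq (var Sg) :=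
  match t with
  | Var x => [:: x]
  | App _ ts => flatten (map tvars ts)
  end.

Definition ground (t : term Sg) : bool := nilp (tvars t).

Fixpoint subterms (t : term Sg) : seq (term Sg) :=
  t :: match t with
       | Var _ => [::]
       | App _ ts => flatten (map subterms ts)
       end.

End Syntax.

Definition equation (Sg : signature) : Type := (term Sg * term Sg)%type.

(* A predicate literal is an equation, so a conjunction of literals is a
   sequence of equations. *)
Definition pos_lit (Sg : signature) (p : term Sg) : equation Sg :=
  (p, App (top_sym Sg) [::]).
Definition neg_lit (Sg : signature) (p : term Sg) : equation Sg :=
  (p, App (bot_sym Sg) [::]).

Definition formula (Sg : signature) : Type := seq (equation Sg).

Section Formulas.
Context {Sg : signature}.

Definition eq_wf (e : equation Sg) : bool :=
  (tsort e.1 != None) && (tsort e.1 == tsort e.2).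
Definition formula_wf (phi : formula Sg) : bool := all eq_wf phi.

Definition fvars (phi : formula Sg) : seq (var Sg) :=
  flatten [seq tvars e.1 ++ tvars e.2 | e <- phi].

Definition fsubterms (phi : formula Sg) : seq (term Sg) :=
  flatten [seq subterms e.1 ++ subterms e.2 | e <- phi].

End Formulas.

(* A multi-sorted structure: the carrier of the sort [s] is the fibre
   [{d | dsort d = s}], required to be nonempty.  The values of [interp] on
   argument lists of the wrong sorts are irrelevant junk. *)
Record structure (Sg : signature) := Structure {
  dval : Type;
  dsort : dval -> sort Sg;
  dsort_inhabited : forall s, exists d, dsort d = s;
  interp : sym Sg -> seq dval -> dval;
  interp_sort : forall f ds,
    map dsort ds = dom f -> dsort (interp f ds) = cod f
}.

Section Semantics.
Context {Sg : signature}.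

Fixpoint eval (M : structure Sg) (a : var Sg -> dval M) (t : term Sg) : dval M :=
  match t with
  | Var x => a x
  | App f ts => interp f (map (eval a) ts)
  end.

Definition satisfies (M : structure Sg) (a : var Sg -> dval M) (e : equation Sg)
    : Prop := eval a e.1 = eval a e.2.

(* Entailment of pure EUF: all structures, with no axiom on the two Boolean
   constants. *)
Definition entails (phi : formula Sg) (e : equation Sg) : Prop :=
  forall (M : structure Sg) (a : var Sg -> dval M),
    (forall x, dsort (a x) = vsort x) ->
    (forall e', e' \in phi -> satisfies a e') ->
    satisfies a e.

(* The term L(t_1, ..., t_k), where [L] is a symbol or a variable; variables
   only ever label leaves. *)
Definition mk_term (l : sym Sg + var Sg) (ts : seq (term Sg)) : term Sg :=
  match l with inl f => App f ts | inr x => Var x end.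

End Semantics.

(* [children n] is the ordered list of successors, so it determines the edges.
   [ntt] is determined by the other data through its recursion equation
   [ntt_eq]; it is carried along to avoid a well-founded recursion. *)
Record egraph (Sg : signature) := Egraph {
  node : finType;
  children : node -> seq node;
  label : node -> (sym Sg + var Sg)%type;
  root : node -> node;
  ntt : node -> term Sg
}.

Section EGraph.
Context {Sg : signature} {G : egraph Sg}.
Implicit Types n m c p : node G.

Definition deg n : nat := size (children n).
(* Children are indexed from 0. *)
Definition child n (i : nat) : node G := nth n (children n) i.
Definition leaf n : bool := deg n == 0.
Definition parents n : {set node G} := [set p | n \in children p].
Definition class n : {set node G} := [set n' | root n' == root n].

Definition congruent n n' : bool :=
  [&& label n == label n', deg n == deg n', 0 < deg n
    & [forall i : 'I_(deg n), root (child n i) == root (child n' i)]].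

Definition acyclic (e : rel (node G)) : bool :=
  [forall n, forall n', e n n' ==> ~~ connect e n' n].

Record egraph_wf : Prop := EgraphWf {
  egraph_dag : acyclic (fun n c => c \in children n);
  var_leaf : forall n x, label n = inr x -> leaf n;
  root_congr : forall n n', congruent n n' -> root n = root n';
  ntt_eq : forall n, ntt n = mk_term (label n) (map (@ntt Sg G) (children n));
  ntt_inj : injective (@ntt Sg G)
}.

Inductive cong_closure (phi : formula Sg) : node G -> node G -> Prop :=
| cc_eq n n' : (ntt n, ntt n') \in phi -> cong_closure phi n n'
| cc_refl n : cong_closure phi n n
| cc_sym n n' : cong_closure phi n n' -> cong_closure phi n' n
| cc_trans n n' n'' :
    cong_closure phi n n' -> cong_closure phi n' n'' -> cong_closure phi n n''
| cc_congr n n' :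
    label n = label n' -> deg n = deg n' -> 0 < deg n ->
    (forall i, i < deg n -> cong_closure phi (child n i) (child n' i)) ->
    cong_closure phi n n'.

End EGraph.

Arguments egraph_wf {Sg} G.

(* [is_egraph phi G] : G = egraph(phi), up to the names of the nodes and the
   choice of the root function. *)
Definition is_egraph (Sg : signature) (phi : formula Sg) (G : egraph Sg) : Prop :=
  [/\ egraph_wf G,
      forall t, t \in fsubterms phi <-> exists n : node G, ntt n = t
    & forall n n' : node G, root n = root n' <-> cong_closure phi n n'].

(* [None] is the undefined representative. *)
Definition repfun (Sg : signature) (G : egraph Sg) : Type :=
  {ffun node G -> option (node G)}.

(* The loops may traverse their sets in any order, so the algorithm is
   nondeterministic: each procedure is given as the relation between its input
   and its possible results.  The lists [s] and [o] below are traversal orders.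
   [class n] is always the full rho_root-class, independently of [r]. *)
Section QEL.
Context {Sg : signature} {G : egraph Sg}.
Implicit Types (n m c p : node G) (r : repfun G) (core todo S : {set node G})
  (vs : seq (var Sg)).

Definition rep_edge r : rel (node G) :=
  fun n m => [exists c, (c \in children n) && (r c == Some m)].

Definition reachable r n m : bool := connect (rep_edge r) n m.

(* [toexpr r n t] : toexpr(n, r) = t.  There is no such [t] if the recursion
   meets an undefined representative or does not terminate. *)
Inductive toexpr r : node G -> term Sg -> Prop :=
| toexpr_node n ms ts :
    map r (children n) = map Some ms ->
    List.Forall2 (toexpr r) ms ts ->
    toexpr r n (mk_term (label n) ts).

Definition toformula r S (psi : formula Sg) : Prop :=
  exists2 s : seq (node G * node G),
    perm_eq s (enum [set mn | [&& r mn.1 == Some mn.1,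
                                  mn.2 \in class mn.1 :\ mn.1
                                & mn.2 \notin S]])
  & List.Forall2 (fun mn e => toexpr r mn.1 e.1 /\ toexpr r mn.2 e.2) s psi.

Definition label_in vs n : bool :=
  if label n is inr x then x \in vs else false.

Definition assign r n m : repfun G :=
  [ffun n' => if n' \in class n then Some m else r n'].

Definition ready r n : {set node G} :=
  [set p | [exists n' in class n, p \in parents n']
           && all (fun c => r c != None) (children p)].

Inductive process : {set node G} -> repfun G -> repfun G -> Prop :=
| process_done r : process set0 r r
| process_skip todo r r' n :
    n \in todo -> r n != None ->
    process (todo :\ n) r r' -> process todo r r'
| process_step todo r r' n :
    n \in todo -> r n = None ->
    process (todo :\ n :|: ready (assign r n n) n) (assign r n n) r' ->
    process todo r r'.

Definition finddefs r : Prop :=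
  exists2 r1 : repfun G,
    process [set n | leaf n && ground (ntt n)] [ffun => None] r1
  & process [set n | leaf n] r1 r.

Definition refinement vs r n n' : bool :=
  ~~ label_in vs n' && acyclic (rep_edge (assign r n n')).

Definition refine_node vs r n (o : seq (node G)) : repfun G :=
  if (r n == Some n) && label_in vs n
  then assign r n (head n [seq n' <- o | refinement vs r n n'])
  else r.

Inductive refine_loop vs : seq (node G) -> repfun G -> repfun G -> Prop :=
| refine_done r : refine_loop vs [::] r r
| refine_next n s o r r' :
    perm_eq o (enum (class n :\ n)) ->
    refine_loop vs s (refine_node vs r n o) r' ->
    refine_loop vs (n :: s) r r'.

Definition refinedefs vs r r' : Prop :=
  exists2 s, perm_eq s (enum (node G)) & refine_loop vs s r r'.

Definition core_add vs core n' : {set node G} :=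
  if label_in vs n' || [exists m in core, congruent m n'] then core
  else n' |: core.

Inductive core_loop vs : seq (node G) -> {set node G} -> {set node G} -> Prop :=
| core_done core : core_loop vs [::] core core
| core_next n s o core core' :
    perm_eq o (enum (class n :\ n)) ->
    core_loop vs s (foldl (core_add vs) (n |: core) o) core' ->
    core_loop vs (n :: s) core core'.

Definition findcore vs r core : Prop :=
  exists2 s, perm_eq s (enum [set n | r n == Some n])
           & core_loop vs s set0 core.

(* A run of QEL on the egraph [G], with its final representative function
   [r], its core and its output [psi]. *)
Definition QEL_run vs r core (psi : formula Sg) : Prop :=
  exists r0 : repfun G,
    [/\ finddefs r0, refinedefs vs r0 r, findcore vs r core
       & toformula r (~: core) psi].

Definition NS core : {set node G} :=
  [set n in core | class n :&: core != [set n]].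

End QEL.

(* Main.v *)
(* A variable of the output comes from a node of NS from which [nv] is reachable;
   this settles hypothesis (2).  Under (1), it is enough that [nv] does not
   represent its class: it is then reachable from itself only, and it is not in
   the core.  For this, the first pass of finddefs, which starts from the ground
   leaves, must define a representative for the class of [nv].  Otherwise, take
   the structure of the classes of the egraph, completed with one junk value per
   sort for all applications that match no node.  It satisfies phi, while ground
   terms take only junk values and classes with a representative after the first
   pass, so no ground term equals [v] in it. *)

Require Import Defs.
From mathcomp Require Import all_boot.

Set Implicit Arguments.
Unset Strict Implicit.
Unset Printing Implicit Defensive.

(* Unqualified, [root] and [sort] would be those of [fingraph] and [path]. *)
Local Notation root := (@Defs.root _ _).

(** * Terms: groundness, subterms and sorts *)

Section Terms.
Context {Sg : signature}.
Implicit Types (t u : term Sg) (phi : formula Sg).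

Lemma term_mem_ind (P : term Sg -> Prop) :
  (forall x, P (Var x)) ->
  (forall f ts, (forall t, t \in ts -> P t) -> P (App f ts)) ->
  forall t, P t.
Proof.
move=> Pvar Papp; elim=> // f ts IH; apply: Papp.
elim: ts IH => //= u ts IHts [Pu /IHts Pts] t.
by rewrite inE => /predU1P[->|/Pts].
Qed.

Lemma groundP t : reflect (forall x, x \notin tvars t) (ground t).
Proof.
rewrite /ground; case: (tvars t) => [|y s]; constructor=> // /(_ y).
by rewrite mem_head.
Qed.

Lemma ground_args f ts : ground (App f ts) -> {in ts, forall t, ground t}.
Proof.
move=> /groundP gr t tts; apply/groundP => x.
by apply: contra (gr x) => xt; apply/flatten_mapP; exists t.
Qed.

Lemma subterms_refl t : t \in subterms t.
Proof. by case: t => *; rewrite mem_head. Qed.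

Lemma tsort_subterm t u : tsort t != None -> u \in subterms t -> tsort u != None.
Proof.
elim/term_mem_ind: t => [x|f ts IH]; first by rewrite inE => ? /eqP->.
rewrite inE => wf /predU1P[->//|/flatten_mapP[t tts]]; apply: IH => //.
move: wf => /=; case: ifP => // /eqP eq_dom _.
have : tsort t \in map Some (dom f) by rewrite -eq_dom map_f.
by case/mapP => s _ ->.
Qed.

Lemma tsort_fsubterm phi t : formula_wf phi -> t \in fsubterms phi -> tsort t != None.
Proof.
move=> /allP wf /flatten_mapP[e /wf/andP[e1 /eqP e12]].
by rewrite mem_cat => /orP[]; apply: tsort_subterm; rewrite -?e12.
Qed.

Lemma fsubterms_eq phi e :
  e \in phi -> e.1 \in fsubterms phi /\ e.2 \in fsubterms phi.
Proof.
by move=> ephi; split; apply/flatten_mapP; exists e => //;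
  rewrite mem_cat subterms_refl ?orbT.
Qed.

End Terms.

Lemma Forall2_inr (A B : eqType) (R : A -> B -> Prop) s1 s2 y :
  List.Forall2 R s1 s2 -> y \in s2 -> exists2 x, x \in s1 & R x y.
Proof.
elim=> //= a b s1' s2' Rab _ IH; rewrite inE => /predU1P[->|/IH[x x1 Rxy]].
  by exists a; rewrite ?mem_head.
by exists x; rewrite // inE x1 orbT.
Qed.

(** * Nodes, labels and classes of an egraph *)

Section EGraphs.
Context {Sg : signature} {G : egraph Sg}.
Implicit Types (n m c p : node G) (r : repfun G) (vs : seq (var Sg)).
Hypothesis wfG : egraph_wf G.

Lemma leafP n : reflect (children n = [::]) (leaf n).
Proof. exact: nilP. Qed.

Lemma mem_class n : n \in class n.
Proof. by rewrite inE. Qed.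

Lemma label_var_inj n n' x : label n = inr x -> label n' = inr x -> n = n'.
Proof.
by move=> Ln Ln'; apply: (ntt_inj wfG); rewrite !(ntt_eq wfG) Ln Ln'.
Qed.

Lemma ground_leaf n f : leaf n -> label n = inl f -> ground (ntt n).
Proof. by rewrite (ntt_eq wfG) => /leafP-> ->. Qed.

(** [root_congr] speaks only of positive degree; two leaves with equal labels have the same term,
    hence are one node. *)
Lemma root_eq_children n n' :
  label n = label n' -> map root (children n) = map root (children n') ->
  root n = root n'.
Proof.
move=> eqL eqC; have [leafn|nleafn] := boolP (leaf n).
  have /leafP Cn := leafn; move: eqC; rewrite Cn => /esym/eqP.
  rewrite -size_eq0 size_map size_eq0 => /eqP Cn'.
  by congr root; apply: (ntt_inj wfG); rewrite !(ntt_eq wfG) Cn Cn' eqL.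
have eqD : deg n = deg n' by rewrite /deg -(size_map root) eqC size_map.
apply: (root_congr wfG); rewrite /congruent eqL eqD !eqxx -eqD lt0n nleafn /=.
apply/forallP => i; rewrite /child.
have := congr1 (fun s => nth (root n) s i) eqC.
by rewrite (nth_map n) // (nth_map n') -?[size _]eqD // => /eqP.
Qed.

(** * Invariants of representative functions *)

Definition class_constant r := forall n n', root n = root n' -> r n = r n'.
Definition class_choice r := forall n m, r n = Some m -> m \in class n.

Lemma assign_constant r n m : class_constant r -> class_constant (assign r n m).
Proof. by move=> cst n1 n2 e; rewrite !ffunE !inE e (cst _ _ e). Qed.

Lemma assign_choice r n m :
  m \in class n -> class_choice r -> class_choice (assign r n m).
Proof.
move=> mn ch n' m'; rewrite ffunE; case: ifP => [|_ /ch//].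
by move: mn; rewrite !inE => /eqP eq_mn /eqP eq_n'n [<-]; rewrite eq_mn eq_n'n.
Qed.

Lemma rep_idem r n m :
  class_constant r -> class_choice r -> r n = Some m -> r m = Some m.
Proof.
move=> cst ch rn; rewrite -rn; apply: cst.
by have /ch := rn; rewrite inE => /eqP.
Qed.

Lemma assign_self r n m : assign r n m n = Some m.
Proof. by rewrite ffunE mem_class. Qed.

Lemma assign_extends r n m n' m' : class_constant r -> r n = None ->
  r n' = Some m' -> assign r n m n' = Some m'.
Proof.
by move=> cst rn rn'; rewrite ffunE inE; case: eqP => // /cst; rewrite rn rn'.
Qed.

(** * The worklist process *)

Lemma process_constant todo r r' :
  process todo r r' -> class_constant r -> class_constant r'.
Proof.
by elim=> // {}todo {}r {}r' n _ _ _ IH cst; apply/IH/assign_constant.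
Qed.

Lemma process_choice todo r r' :
  process todo r r' -> class_choice r -> class_choice r'.
Proof.
by elim=> // {}todo {}r {}r' n _ _ _ IH ch; apply/IH/assign_choice/ch/mem_class.
Qed.

Lemma process_extends todo r r' n m : process todo r r' ->
  class_constant r -> r n = Some m -> r' n = Some m.
Proof.
elim=> // {}todo {}r {}r' n' _ rn' _ IH cst rn.
by apply: IH; [apply: assign_constant | apply: assign_extends].
Qed.

Definition var_label n := if label n is inr _ then true else false.

Lemma ready_not_var r n p : p \in ready r n -> ~~ var_label p.
Proof.
rewrite !inE => /andP[/existsP[c /andP[_]]]; rewrite inE /var_label => cp _.
case Lp: (label p) => [//|x]; move/(var_leaf wfG)/leafP: Lp cp => ->.
by rewrite in_nil.
Qed.

(** Representatives are drawn from the worklist, and the nodes added to it later have children,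
    which variable nodes lack. *)
Lemma process_not_var todo r r' : process todo r r' ->
  (forall n, n \in todo -> ~~ var_label n) ->
  (forall n m, r n = Some m -> ~~ var_label m) ->
  forall n m, r' n = Some m -> ~~ var_label m.
Proof.
elim=> {todo r r'} // [todo r r' n _ _ _ IH|todo r r' n ntodo _ _ IH] nvtodo nvr.
  by apply: IH => // p; rewrite in_setD1 => /andP[_ /nvtodo].
apply: IH => [p|].
  by rewrite inE in_setD1 => /orP[/andP[_ /nvtodo]|/ready_not_var].
by move=> n' m; rewrite ffunE; case: ifP => [_ [<-]|_ /nvr//]; apply: nvtodo.
Qed.

Lemma process_mem todo r r' n : process todo r r' ->
  n \in todo \/ r n != None -> r' n != None.
Proof.
elim=> {todo r r'} [r|todo r r' m _ rm _ IH|todo r r' m _ rm _ IH].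
- by rewrite inE => -[].
- move=> H; apply: IH; rewrite in_setD1.
  by have [->|_] := eqVneq n m; [right | case: H; [left | right]].
move=> H; apply: IH; rewrite !inE ffunE inE.
have [->|_] := eqVneq n m; first by right; rewrite eqxx.
by case: H => [->|rn]; [left | right; case: ifP].
Qed.

(** The hypothesis is a loop invariant: a non-leaf whose children are all defined is pending or
    defined. At the end nothing is pending. *)
Lemma process_closed todo r r' : process todo r r' ->
  (forall p, ~~ leaf p -> {in children p, forall c, r c != None} ->
     p \in todo \/ r p != None) ->
  forall p, ~~ leaf p -> {in children p, forall c, r' c != None} ->
    r' p != None.
Proof.
elim=> {todo r r'} [r|todo r r' n _ rn _ IH|todo r r' n _ rn _ IH] cl.
- by move=> p lp /cl-/(_ lp); rewrite inE => -[].
- apply: IH => p lp /cl-/(_ lp) H; rewrite in_setD1.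
  by have [->|_] := eqVneq p n; [right | case: H; [left | right]].
apply: IH => p lp Cp.
have [->|neq_pn] := eqVneq p n; first by right; rewrite assign_self.
(* Either a child of [p] lies in the class just assigned, so [p] is ready and joins the worklist, or
   no child was affected and the old invariant applies. *)
have [/hasP[c cp cn]|/hasPn noc] := boolP (has (mem (class n)) (children p)).
  left; rewrite inE; apply/orP; right; rewrite inE; apply/andP; split; last exact/allP.
  by apply/existsP; exists c; apply/andP; split; rewrite // inE.
have /cl-/(_ lp) : {in children p, forall c, r c != None}.
  by move=> c cp; have := Cp c cp; rewrite ffunE; case: ifP => // cn; case/negP: (noc c cp).
case=> [ptodo|rp]; first by left; rewrite !inE neq_pn ptodo.
by right; rewrite ffunE; case: ifP.
Qed.

Lemma finddefs_constant r : finddefs r -> class_constant r.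
Proof.
case=> r1 P1 P2; apply: (process_constant P2); apply: (process_constant P1).
by move=> n n' _; rewrite !ffunE.
Qed.

Lemma finddefs_choice r : finddefs r -> class_choice r.
Proof.
case=> r1 P1 P2; apply: (process_choice P2); apply: (process_choice P1).
by move=> n n'; rewrite ffunE.
Qed.

Section GroundPass.
Variable r : repfun G.
Hypothesis run :
  process [set n : node G | leaf n && ground (ntt n)] [ffun => None] r.

Lemma ground_pass_constant : class_constant r.
Proof. by apply: process_constant run _ => n n' _; rewrite !ffunE. Qed.

Lemma ground_pass_not_var n m : r n = Some m -> ~~ var_label m.
Proof.
apply: (process_not_var run) => [p|p q]; last by rewrite ffunE.
rewrite inE => /andP[_]; rewrite (ntt_eq wfG) /var_label.
by case: (label p).
Qed.

Lemma ground_pass_closed n f : label n = inl f ->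
  {in children n, forall c, r c != None} -> r n != None.
Proof.
move=> Ln Cn; have [ln|ln] := boolP (leaf n).
  by apply: (process_mem run); left; rewrite inE ln (ground_leaf ln Ln).
apply: (process_closed run) Cn => // p lp Cp.
(* Initially nothing is defined, so the invariant is vacuous: a non-leaf has an undefined child. *)
move: lp; rewrite /leaf /deg; case: (children p) Cp => // c s.
by move=> /(_ c (mem_head _ _)); rewrite ffunE.
Qed.

End GroundPass.

(** * Refinement of representatives *)

Lemma head_filter_class (P : pred (node G)) n o :
  perm_eq o (enum (class n :\ n)) -> head n (filter P o) \in class n.
Proof.
(* If no candidate passes the filter, [head] falls back on [n] itself. *)
move=> po; case E: (filter P o) => [|m s] /=; first exact: mem_class.
have : m \in filter P o by rewrite E mem_head.
by rewrite mem_filter (perm_mem po) mem_enum in_setD1 => /and3P[].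
Qed.

Lemma refine_loop_constant vs s r r' :
  refine_loop vs s r r' -> class_constant r -> class_constant r'.
Proof.
elim=> // n {}s o {}r {}r' _ _ IH cst; apply: IH; rewrite /refine_node.
by case: ifP => // _; apply: assign_constant.
Qed.

Lemma refine_loop_choice vs s r r' :
  refine_loop vs s r r' -> class_choice r -> class_choice r'.
Proof.
elim=> // n {}s o {}r {}r' po _ IH ch; apply: IH; rewrite /refine_node.
by case: ifP => // _; apply: assign_choice => //; apply: head_filter_class.
Qed.

(** Refinement reassigns a class only when its current representative carries a variable of [vs]. *)
Lemma refine_loop_fixed vs s r r' n m : refine_loop vs s r r' ->
  class_constant r -> r n = Some m -> ~~ label_in vs m -> r' n = Some m.
Proof.
move=> run; elim: run => // p {}s o {}r {}r' po _ IH cst rn Lm.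
apply: IH => //; rewrite /refine_node; case: ifP => //.
  by move=> _; apply: assign_constant.
move=> /andP[/eqP rp Lp]; rewrite ffunE inE; case: eqP => // /cst.
by rewrite rn rp => -[eq_mp]; rewrite -eq_mp (negPf Lm) in Lp.
Qed.

(** * Membership in the core *)

Lemma foldl_core_add vs o (core : {set node G}) n :
  n \in foldl (core_add vs) core o -> n \in core \/ ~~ label_in vs n.
Proof.
elim: o core => [|m o IH] core /=; first by left.
move=> /IH[|]; last by right.
rewrite /core_add; case: ifP => [_|/negbT]; first by left.
by rewrite negb_or => /andP[Lm _]; rewrite inE in_set1 => /predU1P[->|]; [right | left].
Qed.

Lemma sub_foldl_core_add vs o (core : {set node G}) :
  core \subset foldl (core_add vs) core o.
Proof.
elim: o core => [|m o IH] core //=; apply: subset_trans (IH _).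
by rewrite /core_add; case: ifP => // _; apply: subsetUr.
Qed.

Lemma core_loop_sub vs s (core core' : {set node G}) :
  core_loop vs s core core' -> forall n, (n \in s) || (n \in core) -> n \in core'.
Proof.
elim=> [//|m {}s o {}core {}core' _ _ IH] n; rewrite inE => H; apply: IH.
have [//|/= ns] := boolP (n \in s); apply: (subsetP (sub_foldl_core_add _ _ _)).
by rewrite !inE; move: H; rewrite (negPf ns) orbF.
Qed.

Lemma core_loop_mem vs s (core core' : {set node G}) n :
  core_loop vs s core core' -> n \in core' ->
  [\/ n \in s, n \in core | ~~ label_in vs n].
Proof.
elim=> [{}core nc|m {}s o {}core {}core' _ _ IH /IH]; first by constructor 2.
rewrite inE; case=> [->|/foldl_core_add[]|]; rewrite ?orbT; try by constructor.
by rewrite inE in_set1 => /orP[->|]; constructor.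
Qed.

Lemma findcore_rep vs r core n : findcore vs r core -> r n = Some n -> n \in core.
Proof.
case=> s ps run rn; apply: (core_loop_sub run).
by rewrite (perm_mem ps) mem_enum inE rn eqxx.
Qed.

(** Only representatives enter the core without passing the test on variable labels. *)
Lemma findcore_var vs r core n :
  findcore vs r core -> n \in core -> label_in vs n -> r n = Some n.
Proof.
case=> s ps run /(core_loop_mem run); rewrite (perm_mem ps) mem_enum !inE.
by case=> // [/eqP//|/negPf->].
Qed.

(** * Output expressions and reachability *)

Lemma toexpr_inv r n t : toexpr r n t ->
  exists ms ts, [/\ t = mk_term (label n) ts, map r (children n) = map Some ms
                  & List.Forall2 (toexpr r) ms ts].
Proof. by case=> n' ms ts ? ?; exists ms, ts. Qed.

(** Each recursive call of [toexpr] follows an edge of [rep_edge r], and an occurrence of [v] ends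
    at the only node labelled with [v]. *)
Lemma toexpr_var_reachable r n nv v t :
  label nv = inr v -> toexpr r n t -> v \in tvars t -> reachable r n nv.
Proof.
move=> Lnv; elim/(@term_mem_ind Sg): t n => [x|f us IH] n
  /toexpr_inv[ms [ts []]]; case Ln: (label n) => [g|y] //.
  move=> [->] _ _; rewrite inE => /eqP eq_vy; rewrite -eq_vy in Ln.
  by rewrite (label_var_inj Ln Lnv); apply: connect0.
case=> _ <- rms Fts /flatten_mapP[t tus vt].
have [m mms mt] := Forall2_inr Fts tus.
have : Some m \in map r (children n) by rewrite rms map_f.
case/mapP => c cn rc; apply: connect_trans (IH t tus m mt vt).
by apply: connect1; apply/existsP; exists c; rewrite cn -rc eqxx.
Qed.

(** Every edge ends at a representative, so only the empty path can end at [nv]. *)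
Lemma reachable_not_rep r n nv : class_constant r -> class_choice r ->
  r nv != Some nv -> reachable r n nv -> n = nv.
Proof.
move=> cst ch rnv /connectP[p]; case/lastP: p => [_ ->//|p q].
rewrite rcons_path last_rcons => /andP[_ /existsP[c /andP[_ /eqP rc]]] eq_nv.
by move: rnv; rewrite eq_nv (rep_idem cst ch rc) eqxx.
Qed.

Lemma toformula_mem r S (psi : formula Sg) e : toformula r S psi -> e \in psi ->
  exists mn : node G * node G,
    [/\ r mn.1 = Some mn.1, root mn.2 = root mn.1, mn.2 != mn.1 & mn.2 \notin S] /\
    (toexpr r mn.1 e.1 /\ toexpr r mn.2 e.2).
Proof.
case=> s ps Fs /(Forall2_inr Fs)[mn mns He]; exists mn; split=> //.
move: mns; rewrite (perm_mem ps) mem_enum !inE.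
by case/and3P => /eqP ? /andP[? /eqP ?].
Qed.

End EGraphs.

(** * The structure of node classes and junk values *)

Section Model.
Context {Sg : signature} {G : egraph Sg}.
Variable phi : formula Sg.
Hypotheses (wf_phi : formula_wf phi) (egG : is_egraph phi G).
Implicit Types n : node G.

Let wfG : egraph_wf G.
Proof. by case: egG. Qed.

(** This gives each class a sort: equations of [phi] are well-sorted, and the sort of an application
    depends only on its symbol and the sorts of its arguments. *)
Lemma cong_closure_tsort n n' : cong_closure phi n n' -> tsort (ntt n) = tsort (ntt n').
Proof.
elim=> {n n'} // [n n' e|n n' n'' _ -> _ ->//|n n' eqL eqD _ _ IH].
  by have /andP[_ /eqP] := allP wf_phi _ e.
rewrite !(ntt_eq wfG) -eqL; case: (label n) => //= f.
suff -> : map tsort (map (@ntt _ G) (children n)) = map tsort (map (@ntt _ G) (children n')) by [].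
rewrite -!map_comp; apply: (@eq_from_nth _ None); rewrite !size_map // => i lti.
by rewrite (nth_map n) // (nth_map n') -?[size _]eqD //; apply: IH.
Qed.

(* [root n] itself need not lie in [class n]. *)
Definition canon n : node G := odflt n [pick n' in class n].

Lemma canon_mem n : root (canon n) = root n.
Proof.
rewrite /canon; case: pickP => //= n'; rewrite inE; exact/eqP.
Qed.

Lemma canon_eq n n' : root n = root n' -> canon n = canon n'.
Proof.
move=> e; rewrite /canon; have -> : class n = class n' by apply/setP=> m; rewrite !inE e.
by case: pickP => // /(_ n'); rewrite mem_class.
Qed.

Lemma tsort_canon n : tsort (ntt (canon n)) = tsort (ntt n).
Proof. by case: egG => _ _ cc; apply/cong_closure_tsort/cc/canon_mem. Qed.

(* One element per class, and one junk element per sort, which is the value of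
   every application that matches no node of the egraph. *)
Definition model_val : eqType := (node G + Defs.sort Sg)%type.

Definition model_sort (d : model_val) : Defs.sort Sg :=
  match d with
  | inl n => odflt (bool_sort Sg) (tsort (ntt n))
  | inr s => s
  end.

Definition model_app (f : sym Sg) (ds : seq model_val) : model_val :=
  if [pick n | (label n == inl f) && (map (fun c => inl (canon c)) (children n) == ds)]
    is Some n then inl (canon n) else inr (cod f).

Lemma model_app_sort f ds : map model_sort ds = dom f -> model_sort (model_app f ds) = cod f.
Proof.
move=> _; rewrite /model_app; case: pickP => //= n /andP[/eqP Ln _].
rewrite tsort_canon; case: egG => _ sub _.
have /(tsort_fsubterm wf_phi) : ntt n \in fsubterms phi by apply/sub; exists n.
by rewrite (ntt_eq wfG) Ln /=; case: ifP.
Qed.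

Lemma model_inhabited s : exists d, model_sort d = s.
Proof. by exists (inr s). Qed.

Definition model : structure Sg := Structure model_inhabited model_app_sort.

Definition model_var (x : var Sg) : model_val :=
  if [pick n | label n == inr x] is Some n then inl (canon n) else inr (vsort x).

Lemma model_var_sort x : model_sort (model_var x) = vsort x.
Proof.
rewrite /model_var; case: pickP => //= n /eqP Ln.
by rewrite tsort_canon (ntt_eq wfG) Ln.
Qed.

(** The choice made by [pick] is immaterial: nodes with the same symbol and the same classes of
    children share a class. *)
Lemma model_app_node n f :
  label n = inl f ->
  model_app f (map (fun c => inl (canon c)) (children n)) = inl (canon n).
Proof.
move=> Ln; rewrite /model_app; case: pickP => [n' /andP[/eqP Ln' /eqP eqC]|/(_ n)].
  congr inl; apply: canon_eq; apply: (root_eq_children wfG); first by rewrite Ln Ln'.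
  (* Reads the classes of the children back from the values; the branch for junk is arbitrary, as no
     value here is junk. *)
  have := congr1 (map (fun d : model_val => if d is inl c then root c else root n)) eqC.
  rewrite -!map_comp => eqC'.
  by rewrite -(eq_map canon_mem) -[RHS](eq_map canon_mem).
by rewrite Ln !eqxx.
Qed.

Lemma eval_node n : eval (M := model) model_var (ntt n) = inl (canon n).
Proof.
(* The equation keeps [n] general while the induction runs on its term. *)
move: {2}(ntt n) (erefl (ntt n)) => t; elim/(@term_mem_ind Sg): t n => [x|f ts IH] n.
all: rewrite (ntt_eq wfG); case Ln: (label n) => [g|y] //=.
  move=> _; rewrite /model_var; case: pickP => [n' /eqP Ln'|/(_ n)].
    by rewrite (label_var_inj wfG Ln' Ln).
  by rewrite Ln eqxx.
case=> _ eq_ts; rewrite -(model_app_node Ln) -map_comp; congr (model_app g).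
by apply/eq_in_map => c cn; apply: (IH (ntt c)) => //; rewrite -eq_ts map_f.
Qed.

Lemma model_satisfies e : e \in phi -> satisfies (M := model) model_var e.
Proof.
case: egG => _ sub cc; case: e => t1 t2 ephi.
have [/sub[n1 /= e1] /sub[n2 /= e2]] := fsubterms_eq ephi; subst t1 t2.
rewrite /satisfies !eval_node; congr inl; apply: canon_eq.
exact/cc/cc_eq.
Qed.

(* Applications of junk are junk, so the junk values and the classes in [P] form
   a subalgebra. *)
Lemma eval_ground (P : pred (node G)) t :
  (forall n n', root n = root n' -> P n -> P n') ->
  (forall n f, label n = inl f -> {in children n, forall c, P c} -> P n) ->
  ground t -> if eval (M := model) model_var t is inl n then P n else true.
Proof.
move=> rootP appP; elim/(@term_mem_ind Sg): t => [x|f ts IH] gt.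
  by move/groundP/(_ x): gt; rewrite mem_head.
rewrite /= /model_app; case: pickP => // n /andP[/eqP Ln /eqP eqC].
apply: (rootP n); first by rewrite canon_mem.
apply: (appP _ _ Ln) => c cn.
have : inl (canon c) \in map (eval (M := model) model_var) ts.
  by rewrite -eqC; apply/mapP; exists c.
case/mapP => t tts Et; have := IH t tts (ground_args gt tts).
by rewrite -Et; apply: rootP; apply: canon_mem.
Qed.

(** In [model], [t] must take the class of [n] as its value, and the subalgebra of junk and defined
    classes contains the values of all ground terms. *)
Lemma ground_pass_complete (r : repfun G) n t :
  process [set n : node G | leaf n && ground (ntt n)] [ffun => None] r ->
  ground t -> entails phi (ntt n, t) -> r n != None.
Proof.
move=> run gt /(_ model model_var model_var_sort model_satisfies) Et.
have cst := ground_pass_constant run.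
have := @eval_ground (fun n => r n != None) t _ _ gt.
rewrite -[eval _ t]Et eval_node (cst _ n (canon_mem n)); apply=> [m m' /cst->//|m f].
exact: (ground_pass_closed wfG run).
Qed.

End Model.

Theorem theorem3 (Sg : signature) (phi : formula Sg) (vs : seq (var Sg))
  (v : var Sg) (G : egraph Sg) (nv : node G)
  (r : repfun G) (core : {set node G}) (psi : formula Sg) :
  formula_wf phi ->
  vs =i fvars phi ->
  v \in vs ->
  is_egraph phi G ->
  label nv = inr v ->
  QEL_run vs r core psi ->
  (exists t : term Sg,
      [/\ ground t, tsort t = Some (vsort v) & entails phi (Var v, t)])
  \/ (forall n : node G, n \in NS core -> ~~ reachable r n nv) ->
  v \notin fvars psi.
Proof.
move=> wf_phi _ v_vs egG Lnv [r0 [def_r0 [s _ ref_r] core_r out]] hyp.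
have wfG : egraph_wf G by case: egG.
have cst := refine_loop_constant ref_r (finddefs_constant def_r0).
have ch := refine_loop_choice ref_r (finddefs_choice def_r0).
apply/negP => /flatten_mapP[e e_psi v_e].
have [[m n] /= [[rm root_n neq_nm]]] := toformula_mem out e_psi.
rewrite inE negbK => n_core [m_e1 n_e2].
have m_core := findcore_rep core_r rm.
have reach_nv : reachable r m nv \/ reachable r n nv.
  move: v_e; rewrite mem_cat.
  by case/orP => [/(toexpr_var_reachable wfG Lnv m_e1)|/(toexpr_var_reachable wfG Lnv n_e2)];
     [left | right].
have NS_pair p q : p \in core -> q \in core -> q != p -> root q = root p -> p \in NS core.
  move=> pc qc neq eq_root; rewrite inE pc; apply: contra neq => /eqP/setP/(_ q).
  by rewrite !inE eq_root eqxx qc => <-.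
(* Under (2): [m] and [n] are distinct core nodes of one class, so both lie in [NS], yet one of them
   reaches [nv]. *)
case: hyp => [[t [gt _ Et]]|nreach]; last first.
  case: reach_nv; apply/negP/nreach; first exact: NS_pair n_core _ _.
  by apply: NS_pair m_core _ _ => //; rewrite eq_sym.
(* Under (1): the first pass gives the class of [nv] a representative without variable label, which
   the second pass and refinement keep. *)
have r_nv : r nv != Some nv.
  have [r1 run1 run2] := def_r0.
  have := @ground_pass_complete _ _ _ wf_phi egG r1 nv t run1 gt.
  rewrite (ntt_eq wfG) Lnv => /(_ Et); case r1nv: (r1 nv) => [q|//] _.
  have Lq := ground_pass_not_var wfG run1 r1nv.
  have r0nv := process_extends run2 (ground_pass_constant run1) r1nv.
  rewrite (refine_loop_fixed ref_r (finddefs_constant def_r0) r0nv).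
    by apply: contra Lq => /eqP[->]; rewrite /var_label Lnv.
  by apply: contra Lq; rewrite /label_in /var_label; case: (label q).
(* Now [nv] is [m] or [n]. But [m] represents its class, and a core node labelled with a variable of
   [vs] would do so too. *)
case: reach_nv => /(reachable_not_rep cst ch r_nv) eq_nv.
  by rewrite -eq_nv rm eqxx in r_nv.
by move: r_nv; rewrite -eq_nv (findcore_var core_r n_core) ?eqxx // /label_in eq_nv Lnv.
Qed.
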